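(* Let $(d,p,m)$ be one of the triples $$(3,2,4),(5,3,4),(7,4,4),(9,5,5),(11,6,5),(13,7,5),(15,8,5),(17,9,5),(19,10,5),(21,11,5),(23,12,4),$$ $$(4,3,4),(6,4,4),(8,5,5),(10,6,5),(12,7,5),(14,8,6),(16,9,6),(18,10,6),(20,11,6),(22,12,6),$$ and let $a=\frac{10(p-1)}{d-1}-1$. Then there exist nonnegative real numbers $\lambda_1,\dots,\lambda_6$ with $\sum_{i=1}^6\lambda_i=1$ such that \begin{align*} \int_{\mathbb{S}^d}f\,d\bar\sigma={}&\lambda_1M_f\big(\tfrac1{\sqrt{d+1}}v_{d+1}\big)+\lambda_2M_f(v_1)+\lambda_3M_f\big(\tfrac1{\sqrt2}v_2\big)+\lambda_4M_f\big(\tfrac1{\sqrt3}v_3\big)\\ &+\lambda_5M_f\big(\tfrac1{\sqrt m}v_m\big)+\lambda_6M_f\Big(\tfrac1{\sqrt{a+p}}(\sqrt a,\underbrace{1,\dots,1}_{p},0,\dots,0)\Big) \end{align*} for every polynomial $f$ in $d+1$ variables of degree at most $11$; in particular there is a positive cubature rule of degree $11$ of this form on $\mathbb{S}^d$ for every $3\le d\le23$. If $d$ is odd (so that $d=2p-1$ and $a=4$), the $\lambda_i$ can be taken rational. Moreover, for the following triples one may take: for $(3,2,4)$: $\lambda_1=\frac2{15},\lambda_2=\frac1{15},\lambda_3=\frac18,\lambda_4=0,\lambda_5=0,\lambda_6=\frac{27}{40}$; for $(7,4,4)$: $\lambda_1=\frac{32}{315},\lambda_2=\frac1{105},\lambda_3=\frac2{45},\lambda_4=0,\lambda_5=\frac2{15},\lambda_6=\frac{32}{45}$;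 for $(23,12,4)$: $\lambda_1=0,\lambda_2=\frac1{4095},\lambda_3=0,\lambda_4=0,\lambda_5=\frac{506}{12285},\lambda_6=\frac{11776}{12285}$.
   Context: $\mathbb{S}^d$ is the unit sphere of $\mathbb{R}^{d+1}$ and $\bar\sigma$ its rotation-invariant probability measure (normalized surface measure). $v_k=(1,\dots,1,0,\dots,0)\in\mathbb{R}^{d+1}$ ($k$ ones); the last orbit representative also lies in $\mathbb{R}^{d+1}$. For $y\in\mathbb{R}^{d+1}$, $M_f(y)$ denotes the average of $f$ over the set of distinct points obtained from $y$ by permuting coordinates and changing signs of coordinates arbitrarily. Orbits whose coefficient $\lambda_i$ vanishes are omitted from the rule. *)

(* Defs.v *)
From HB Require Import structures.
From mathcomp Require Import all_boot all_order all_algebra all_fingroup.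
From mathcomp Require Import all_classical all_reals all_analysis.
(* The notations of [mpoly] clash with those of MathComp-Analysis. *)
From mathcomp Require mpoly.
Import -(notations) mpoly.

Set Implicit Arguments.
Unset Strict Implicit.
Unset Printing Implicit Defensive.
Import Order.TTheory GRing.Theory Num.Theory.
Import numFieldNormedType.Exports.

Local Open Scope classical_set_scope.
Local Open Scope ring_scope.

Section SphericalMeasure.
Variables (R : realType) (n : nat).

(* R^n with its Borel sigma-algebra. *)
Definition borel_rV : Type := g_sigma_algebraType (@open 'rV[R]_n).

Definition unit_sphere : set 'rV[R]_n :=
  [set x | \sum_(i < n) x 0 i ^+ 2 = 1].

Definition rotation (A : 'M[R]_n) : Prop := A *m A^T = 1%:M /\ \det A = 1.

(* For n >= 2 there is exactly one such probability measure, the normalized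
   surface measure of the sphere, here seen as a measure on the ambient space. *)
Definition rotation_invariant_on_sphere (sigma : probability borel_rV R) : Prop :=
  sigma unit_sphere = 1%:E /\
  forall A : 'M[R]_n, rotation A -> forall B : set borel_rV, measurable B ->
    sigma ((fun x : 'rV[R]_n => x *m A) @^-1` B) = sigma B.

Definition mpoly_eval (f : mpoly n R) (x : 'rV[R]_n) : R :=
  meval (x 0) f.

(* [mpoly.msize f] is 1 + the total degree of f, and 0 for f = 0. *)
Definition degree_le (t : nat) (f : mpoly n R) : Prop :=
  (mpoly.msize f <= t.+1)%N.

Definition sphere_integral (sigma : probability borel_rV R)
    (f : mpoly n R) : \bar R :=
  (\int[sigma]_(x in unit_sphere) (mpoly_eval f x)%:E)%E.

Definition positive_cubature (t : nat) (X : seq 'rV[R]_n) (w : 'rV[R]_n -> R) :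
    Prop :=
  [/\ uniq X,
      forall x, x \in X -> unit_sphere x,
      forall x, x \in X -> 0 < w x &
      forall sigma, rotation_invariant_on_sphere sigma ->
      forall f, degree_le t f ->
        sphere_integral sigma f = (\sum_(x <- X) w x * mpoly_eval f x)%:E].

End SphericalMeasure.

Section Orbits.
Variables (R : realType) (n : nat).
Implicit Types (y : 'rV[R]_n) (Y : 'I_6 -> 'rV[R]_n) (l : 'I_6 -> R).

(* The distinct points obtained from y by permutations and sign changes of the
   coordinates, listed without repetition. *)
Definition orbit_points y : seq 'rV[R]_n :=
  undup [seq \row_i ((-1) ^+ e i * y 0 (s i))
        | s : 'S_n <- enum {: 'S_n},
          e : {ffun 'I_n -> bool} <- enum {: {ffun 'I_n -> bool}}].

Definition orbit_average (f : mpoly n R) y : R :=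
  (\sum_(z <- orbit_points y) mpoly_eval f z) / (size (orbit_points y))%:R.

Definition convex_weights l : Prop :=
  (forall i, 0 <= l i) /\ \sum_(i < 6) l i = 1.

Definition orbit_rule (t : nat) Y l : Prop :=
  forall sigma, rotation_invariant_on_sphere sigma ->
  forall f : mpoly n R, degree_le t f ->
    sphere_integral sigma f
    = (\sum_(i < 6) l i * orbit_average f (Y i))%:E.

(* Nodes and weights of the rule \sum_i l_i M_f(Y_i): orbits with l_i = 0 are
   omitted, and coinciding orbits add up their weights. *)
Definition rule_nodes Y l : seq 'rV[R]_n :=
  undup (flatten [seq orbit_points (Y i) | i <- enum 'I_6 & l i != 0]).

Definition rule_weight Y l (x : 'rV[R]_n) : R :=
  \sum_(i < 6 | x \in orbit_points (Y i))
     l i / (size (orbit_points (Y i)))%:R.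

End Orbits.

Section Representatives.
Variables (R : realType) (d : nat).

Definition vones (k : nat) : 'rV[R]_d.+1 := \row_i (i < k)%N%:R.

Definition apar (p : nat) : R := 10 * (p%:R - 1) / (d%:R - 1) - 1.

(* (sqrt a, 1, ..., 1, 0, ..., 0) with p ones. *)
Definition last_vector (a : R) (p : nat) : 'rV[R]_d.+1 :=
  \row_i (if i == ord0 then Num.sqrt a else (i <= p)%N%:R).

(* The points y_1, ..., y_6 whose orbits carry the weights lambda_1, ...,
   lambda_6, indexed from 0. *)
Definition representatives (p m : nat) (i : 'I_6) : 'rV[R]_d.+1 :=
  [:: (Num.sqrt d.+1%:R)^-1 *: vones d.+1;
      vones 1;
      (Num.sqrt 2)^-1 *: vones 2;
      (Num.sqrt 3)^-1 *: vones 3;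
      (Num.sqrt m%:R)^-1 *: vones m;
      (Num.sqrt (apar p + p%:R))^-1 *: last_vector (apar p) p]`_i.

End Representatives.

Definition triples : seq (nat * nat * nat) :=
  [:: (3, 2, 4); (5, 3, 4); (7, 4, 4); (9, 5, 5); (11, 6, 5); (13, 7, 5);
      (15, 8, 5); (17, 9, 5); (19, 10, 5); (21, 11, 5); (23, 12, 4);
      (4, 3, 4); (6, 4, 4); (8, 5, 5); (10, 6, 5); (12, 7, 5);
      (14, 8, 6); (16, 9, 6); (18, 10, 6); (20, 11, 6); (22, 12, 6)]%N.

(* Main.v *)
Require Import Defs.
From HB Require Import structures.
From mathcomp Require Import all_boot all_order all_algebra all_fingroup.
From mathcomp Require Import all_classical all_reals all_analysis.
From mathcomp Require Import measurable_realfun.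
From Stdlib Require QArith_base.
Import -(notations) QArith_base.
From mathcomp Require Import zify ssrZ ring lra.
From mathcomp Require mpoly.
Import -(notations) mpoly.
Import Order.TTheory GRing.Theory Num.Theory.
Import numFieldNormedType.Exports.
Set Implicit Arguments.
Unset Strict Implicit.
Unset Printing Implicit Defensive.
Local Open Scope ring_scope.

(* A linear functional [L] on polynomials that is invariant under rotations
   kills [x_j d_i f - x_i d_j f], the derivative of [f] along the rotations of
   the (i, j)-plane. If moreover [L] only sees the values on the sphere, applying
   this to [f = x_j g] and summing over [j != i] gives
   [(n + deg g - 1) L (x_i g) = L (d_i g)] for homogeneous [g], hence all the
   moments of the sphere.

   The difference [F] of the sphere mean and of the cubature functional is
   invariant under (x_i, x_j) -> (x_j, - x_i) and vanishes on monomials with an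
   odd exponent. Write [p_b] for the sum of the [x_k ^ (2 b)]. Multiplying by
   [p_b] a product of power sums and of even powers of some variables, and
   expanding, one sees by induction on the number of variables that [F] vanishes
   in degree <= 11 as soon as it vanishes on the products of the [p_b]'s in that
   degree. Orbits are in the level sets of the [p_b]'s and [p_1 = 1] on the
   sphere, so this amounts to seven linear equations on the weights, for
   1, p_2, p_3, p_4, p_5, p_2^2 and p_2 p_3. Their coefficients are rational, and
   they are checked by computation on explicit solutions. *)

(** * Integration of polynomials on the sphere *)

Section SphereFunctional.
Local Open Scope classical_set_scope.
Variables (R : realType) (n : nat).
Notation borel := (borel_rV R n).

Lemma continuous_measurable_borel_rV (h : 'rV[R]_n -> R) :
  continuous h -> measurable_fun [set: borel] (h : borel -> R).
Proof.
move=> /continuousP ch.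
(* Open intervals generate the Borel sets of the line, and [h] pulls them back to open sets. *)
apply: (measurability _ (measurable_realfun.RGenOpens.measurableE R)).
move=> _ [_ [a [b ->] <-]]; rewrite setTI.
by apply: sub_sigma_algebra; exact/ch/interval_open.
Qed.

Lemma measurable_coord i :
  measurable_fun [set: borel] (fun x : borel => (x : 'rV[R]_n) 0 i).
Proof. by apply: continuous_measurable_borel_rV; exact: coord_continuous. Qed.

Lemma measurable_mpoly_eval (f : mpoly n R) :
  measurable_fun [set: borel] (mpoly_eval f : borel -> R).
Proof.
rewrite (_ : mpoly_eval f = fun x =>
    \sum_(m <- msupp f) mcoeff m f * \prod_i x 0 i ^+ m i); last first.
  by apply/funext => x; rewrite /mpoly_eval mevalE.
apply: measurable_sum => m; apply: measurable_funM; first exact: measurable_cst.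
apply: measurable_prod => i _; apply: measurable_funX; exact: measurable_coord.
Qed.

Lemma measurable_unit_sphere : measurable (@unit_sphere R n : set borel).
Proof.
have mf : measurable_fun [set: borel] (fun x : borel => \sum_i ((x : 'rV[R]_n) 0 i) ^+ 2).
  apply: measurable_sum => i; apply: measurable_funX; exact: measurable_coord.
have := mf measurableT [set 1] (measurable_set1 1).
rewrite setTI; congr measurable; apply/seteqP; split => x //=.
Qed.

Lemma measurable_mulmxr (A : 'M[R]_n) :
  measurable_fun [set: borel] ((fun x : 'rV[R]_n => x *m A) : borel -> borel).
Proof.
have cA : continuous (fun x : 'rV[R]_n => x *m A).
  have -> : (fun x : 'rV[R]_n => x *m A) = (fun x : 'rV[R]_n => \sum_i x 0 i *: row i A).
    by apply/funext => x; exact: mulmx_sum_row.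
  apply: continuous_big; first exact: add_continuous.
  move=> i _ x; apply: cvgZr_tmp; [exact: nbhs_filter|exact: coord_continuous].
apply: (@measurability _ _ borel borel setT _ (@open 'rV[R]_n) erefl).
move=> _ [U oU <-]; rewrite setTI; apply: sub_sigma_algebra.
by move/continuousP: cA; exact.
Qed.

Lemma unit_sphere_norm_coord_le1 (x : 'rV[R]_n) i : unit_sphere x -> `|x 0 i| <= 1.
Proof.
rewrite /unit_sphere /= => sx; rewrite -(@ler_pXn2r _ 2)// ?nnegrE// expr1n.
rewrite -normrX ger0_norm ?sqr_ge0// -sx (bigD1 i)//= lerDl.
by apply: sumr_ge0 => j _; exact: sqr_ge0.
Qed.

Variable sigma : probability borel R.

Lemma integrable_mpoly_eval (f : mpoly n R) :
  sigma.-integrable (@unit_sphere R n) (EFin \o mpoly_eval f).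
Proof.
apply: measurable_bounded_integrable.
- exact: measurable_unit_sphere.
- by apply: (le_lt_trans (probability_le1 _ measurable_unit_sphere)); rewrite ltry.
- by apply: measurable_funTS; exact: measurable_mpoly_eval.
(* Coordinates of unit vectors have absolute value at most 1, so the sum of the absolute values of
   the coefficients bounds [f] on the sphere. *)
rewrite /bounded_near; exists (\sum_(m <- msupp f) `|mcoeff m f|).
split; first exact: num_real.
move=> M ltM x /= sx; apply: le_trans (ltW ltM).
rewrite /mpoly_eval mevalE (le_trans (ler_norm_sum _ _ _))//.
apply: ler_sum => m _; rewrite normrM ler_piMr// normr_prod.
apply: Num.Theory.prodr_ile1 => i _; rewrite normrX exprn_ge0//= exprn_ile1//.
exact: unit_sphere_norm_coord_le1.
Qed.

Definition sphere_mean (f : mpoly n R) : R := fine (sphere_integral sigma f).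

Lemma sphere_integralE f : sphere_integral sigma f = (sphere_mean f)%:E.
Proof.
rewrite /sphere_mean fineK//; apply: integrable_fin_num.
  exact: measurable_unit_sphere.
exact: integrable_mpoly_eval.
Qed.

Lemma sphere_mean_is_scalar : scalar sphere_mean.
Proof.
move=> c f g; apply: EFin_inj; rewrite EFinD EFinM -!sphere_integralE.
have mS := measurable_unit_sphere.
rewrite /sphere_integral -integralZl//; last exact: integrable_mpoly_eval.
rewrite -integralD//; last 2 first.
- by apply: integrableZl => //; exact: integrable_mpoly_eval.
- exact: integrable_mpoly_eval.
by apply: eq_integral => x _; rewrite /mpoly_eval mevalD mevalZ EFinD EFinM.
Qed.

HB.instance Definition _ :=
  GRing.isLinear.Build R (mpoly n R) R *%R sphere_mean sphere_mean_is_scalar.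

Lemma eq_sphere_mean f g :
  (forall x, unit_sphere x -> mpoly_eval f x = mpoly_eval g x) ->
  sphere_mean f = sphere_mean g.
Proof.
move=> fg; congr fine; apply: eq_integral => x; rewrite inE => sx.
by rewrite fg.
Qed.

Hypothesis sigmaP : rotation_invariant_on_sphere sigma.

Lemma sphere_mean1 : sphere_mean 1 = 1.
Proof.
apply: EFin_inj; rewrite -sphere_integralE.
rewrite /sphere_integral (_ : (fun x => _) = cst 1%E); last first.
  by apply/funext => x; rewrite /mpoly_eval meval1.
rewrite integral_cst ?mul1e; last exact: measurable_unit_sphere.
by case: sigmaP.
Qed.

(** Change of variables: [sigma] is its own pushforward under the rotation, and the sphere its own
    preimage. The rotated polynomial enters as any [g] with the right values, which avoids
    substitutions in [mpoly]. *)
Lemma sphere_mean_rotation (A : 'M[R]_n) f g : rotation A ->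
  (forall x, mpoly_eval g x = mpoly_eval f (x *m A)) ->
  sphere_mean g = sphere_mean f.
Proof.
move=> rA gf; congr fine.
have mS := measurable_unit_sphere; have mA := @measurable_mulmxr A.
pose phi := (fun x : 'rV[R]_n => x *m A) : borel -> borel.
have SA : phi @^-1` (@unit_sphere R n) = @unit_sphere R n.
  have normA x : \sum_i (phi x : 'rV[R]_n) 0 i ^+ 2 = \sum_i (x : 'rV[R]_n) 0 i ^+ 2.
    have dotE (y : 'rV[R]_n) : \sum_i y 0 i ^+ 2 = (y *m y^T) 0 0.
      by rewrite mxE; apply: eq_bigr => i _; rewrite mxE expr2.
    by rewrite !dotE /phi trmx_mul mulmxA -(mulmxA x) rA.1 mulmx1.
  by apply/seteqP; split => x; rewrite /unit_sphere /= normA.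
have EA : EFin \o mpoly_eval f \o phi = EFin \o mpoly_eval g.
  by apply/funext => x /=; rewrite gf.
transitivity (\int[pushforward sigma phi]_(x in @unit_sphere R n) (mpoly_eval f x)%:E)%E.
  rewrite (integral_pushforward mA (mu := sigma) (D := @unit_sphere R n)
    (f := EFin \o mpoly_eval f)) //.
  - rewrite SA /sphere_integral; apply: eq_integral => x _.
    by rewrite /= gf.
  - by apply/measurable_EFinP; exact: measurable_mpoly_eval.
  - by rewrite SA EA; exact: integrable_mpoly_eval.
apply: (eq_measure_integral sigma) => B mB _.
by rewrite /pushforward; case: sigmaP => _ /(_ A rA B mB).
Qed.

End SphereFunctional.

(** * Rotation-invariant functionals *)

Section PlaneRotation.
Variables (R : comRingType) (n : nat) (i j : 'I_n).
Hypothesis nij : i != j.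

Definition plane_rot (c s : R) (x : 'rV[R]_n) : 'rV[R]_n :=
  \row_k (if k == i then c * x 0 i + s * x 0 j
          else if k == j then c * x 0 j - s * x 0 i else x 0 k).

Definition plane_rot_mx (c s : R) : 'M[R]_n :=
  \matrix_(l, k) plane_rot c s (delta_mx 0 l) 0 k.

Lemma plane_rot_mxE c s x : x *m plane_rot_mx c s = plane_rot c s x.
Proof.
have sumd k : \sum_l x 0 l * (k == l)%:R = x 0 k.
  rewrite (bigD1 k)//= eqxx mulr1 big1 ?addr0// => l /negPf nlk.
  by rewrite eq_sym nlk mulr0.
apply/rowP => k; rewrite !mxE.
under eq_bigr do rewrite !mxE eqxx /=.
case: ifP => _; [|case: ifP => _]; last exact: sumd.
- under eq_bigr do rewrite mulrDr mulrCA (mulrCA _ s).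
  by rewrite big_split/= -!mulr_sumr !sumd.
- under eq_bigr do rewrite mulrBr mulrCA (mulrCA _ s).
  by rewrite sumrB -!mulr_sumr !sumd.
Qed.

Lemma plane_rot_dot c s (x y : 'rV[R]_n) : c ^+ 2 + s ^+ 2 = 1 ->
  \sum_k plane_rot c s x 0 k * plane_rot c s y 0 k = \sum_k x 0 k * y 0 k.
Proof.
move=> cs; have nji : (j == i) = false by rewrite eq_sym (negPf nij).
rewrite (bigD1 i)//= (bigD1 j) ?nji//= [RHS](bigD1 i)//= [in RHS](bigD1 j) ?nji//=.
rewrite !addrA; congr (_ + _); last first.
  by apply: eq_bigr => k /andP[/negPf ki /negPf kj]; rewrite !mxE ki kj.
rewrite !mxE !eqxx nji.
transitivity ((c ^+ 2 + s ^+ 2) * (x 0 i * y 0 i + x 0 j * y 0 j)); first by ring.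
by rewrite cs mul1r.
Qed.

(** The entries of the product are the dot products of the images of the basis vectors, which
    [plane_rot_dot] preserves. *)
Lemma plane_rot_mx_orthogonal c s : c ^+ 2 + s ^+ 2 = 1 ->
  plane_rot_mx c s *m (plane_rot_mx c s)^T = 1%:M.
Proof.
move=> cs; apply/matrixP => l m; rewrite !mxE.
transitivity (\sum_k plane_rot c s (delta_mx 0 l) 0 k * plane_rot c s (delta_mx 0 m) 0 k).
  by apply: eq_bigr => k _; rewrite [X in _ * X]mxE; rewrite ![in LHS]mxE ![in RHS]mxE.
rewrite plane_rot_dot// (bigD1 l)//= !mxE !eqxx mul1r.
rewrite big1 ?addr0// => k /negPf kl.
by rewrite !mxE kl andbF mul0r.
Qed.

(** The double-angle formulas. The rotations used below are squares, so they arise with a doubled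
    angle. *)
Lemma plane_rot_double c s x :
  plane_rot c s (plane_rot c s x) = plane_rot (c ^+ 2 - s ^+ 2) (2 * c * s) x.
Proof.
have nji : (j == i) = false by rewrite eq_sym (negPf nij).
apply/rowP => k; rewrite !mxE !eqxx nji.
by case: (k == i); [|case: (k == j)]; rewrite /=; ring.
Qed.

End PlaneRotation.

(* Squaring an orthogonal matrix spares the computation of its determinant. *)
Lemma rotation_plane_rot (R : realType) n (i j : 'I_n) (c s : R) : i != j ->
  c ^+ 2 + s ^+ 2 = 1 ->
  rotation (plane_rot_mx i j c s *m plane_rot_mx i j c s).
Proof.
move=> nij cs; have oB := plane_rot_mx_orthogonal nij cs; split.
  by rewrite trmx_mul mulmxA -(mulmxA (plane_rot_mx i j c s)) oB mulmx1.
by rewrite det_mulmx -{2}det_tr -det_mulmx oB det1.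
Qed.

(** In characteristic 0 the naturals below [size p] are distinct, too many roots for a nonzero
    [p]. *)
Lemma poly_fun_eq0 (R : numDomainType) (p : {poly R}) : (forall t, p.[t] = 0) -> p = 0.
Proof.
move=> p0; apply/eqP; apply: contraT => pn0.
have := max_poly_roots (rs := [seq k%:R | k <- iota 0 (size p)]) pn0.
rewrite size_map size_iota ltnn; apply.
  by apply/allP => t _; apply/eqP.
by rewrite map_inj_uniq ?iota_uniq// => a b /eqP; rewrite eqr_nat => /eqP.
Qed.

Section RationalRotation.
Variable A : comNzRingType.

(* [rat_cos / rat_norm] and [rat_sin / rat_norm] are the cosine and the sine of
   [4 * atan 'X]. *)
Definition rat_cos : {poly A} := 1 - 6 *: 'X^2 + 'X^4.
Definition rat_sin : {poly A} := 4 *: 'X - 4 *: 'X^3.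
Definition rat_norm : {poly A} := 1 + 2 *: 'X^2 + 'X^4.

(** Only the coefficients of degree 0 and 1 matter later: they give the derivative of the rotation
    at 0, where the angle has derivative 4. *)
Lemma rat_coef : [/\ rat_cos`_0 = 1, rat_cos`_1 = 0, rat_sin`_0 = 0 & rat_sin`_1 = 4].
Proof. by split; rewrite !coefE/= ?(mulr0, mulr1, subr0, addr0). Qed.

Lemma rat_norm_coef : rat_norm`_0 = 1 /\ rat_norm`_1 = 0.
Proof. by split; rewrite !coefE/= ?(mulr0, mulr1, subr0, addr0). Qed.

Lemma rat_horner t : [/\ rat_cos.[t] = 1 - 6 * t ^+ 2 + t ^+ 4,
  rat_sin.[t] = 4 * t - 4 * t ^+ 3 & rat_norm.[t] = 1 + 2 * t ^+ 2 + t ^+ 4].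
Proof. by split; rewrite !hornerE. Qed.

Lemma rat_rotation_coef a b :
  [/\ (rat_cos * a%:P + rat_sin * b%:P)`_0 = a,
      (rat_cos * a%:P + rat_sin * b%:P)`_1 = 4 * b,
      (rat_cos * b%:P - rat_sin * a%:P)`_0 = b &
      (rat_cos * b%:P - rat_sin * a%:P)`_1 = - (4 * a)].
Proof.
have [C0 C1 S0 S1] := rat_coef; move: C0 C1 S0 S1.
move: rat_cos rat_sin => C S C0 C1 S0 S1 /=.
by rewrite !coefD !coefN !coefMC C0 C1 S0 S1 !(mul1r, mul0r, addr0, add0r, subr0).
Qed.

Lemma rat_norm_coefMC a : (rat_norm * a%:P)`_0 = a /\ (rat_norm * a%:P)`_1 = 0.
Proof. by have [M0 M1] := rat_norm_coef; rewrite !coefMC M0 M1 mul1r mul0r. Qed.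

Lemma rat_norm_exp_coef1 k : (rat_norm ^+ k)`_1 = 0.
Proof.
have [M0 M1] := rat_norm_coef.
elim: k => [|k IH]; first by rewrite expr0 coef1.
by rewrite exprS coefM !big_ord_recl big_ord0 /= IH M1 mulr0 mul0r !addr0.
Qed.

End RationalRotation.

(** Used with [h] the evaluation of [mpoly] at a point and [u] a constant polynomial: it evaluates a
    rotated coordinate both in the parameter and at the point. *)
Lemma rat_rotation_rmorph (A B : comNzRingType) (h : {rmorphism A -> B}) u a b :
  [/\ h (rat_cos A * a%:P + rat_sin A * b%:P).[u] =
         (rat_cos B).[h u] * h a + (rat_sin B).[h u] * h b,
      h (rat_cos A * b%:P - rat_sin A * a%:P).[u] =
         (rat_cos B).[h u] * h b - (rat_sin B).[h u] * h a &
      h (rat_norm A * a%:P).[u] = (rat_norm B).[h u] * h a].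
Proof.
have hM c k : h (c%:R * u ^+ k) = c%:R * h u ^+ k by rewrite rmorphM rmorph_nat rmorphXn.
have [<- <- <-] : [/\ h (rat_cos A).[u] = (rat_cos B).[h u],
    h (rat_sin A).[u] = (rat_sin B).[h u] & h (rat_norm A).[u] = (rat_norm B).[h u]].
  have [-> -> ->] := rat_horner u; have [-> -> ->] := rat_horner (h u).
  split; [rewrite rmorphD rmorphB|rewrite rmorphB|rewrite !rmorphD];
    by rewrite ?rmorph1 ?(hM _ 1%N) ?hM ?rmorphXn.
move: (rat_cos A) (rat_sin A) (rat_norm A) => C S M.
by rewrite !hornerD hornerN !hornerM !hornerC rmorphD rmorphB !rmorphM.
Qed.

Section Rotated.
Variables (R : realType) (n : nat).
Notation P := (mpoly n R).
Notation Xv k := (mpolyX R (mnm1 k) : mpoly n R).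

Definition angular_deriv (i j : 'I_n) (f : P) : P :=
  Xv j * mderiv i f - Xv i * mderiv j f.

Lemma angular_derivM i j f g :
  angular_deriv i j (f * g) = angular_deriv i j f * g + f * angular_deriv i j g.
Proof. by rewrite /angular_deriv !mderivM; ring. Qed.

Lemma mderivXU (i k : 'I_n) : mderiv i (Xv k) = (k == i)%:R.
Proof.
rewrite mderivX mnm1E; case: eqVneq => [->|_]; last by rewrite scale0r.
rewrite scale1r -[RHS]mpolyX0; congr mpolyX.
by apply/mnmP => l; rewrite mnmBE subnn mnm0E.
Qed.

Definition rotation_mean (L : {scalar P}) := forall A f g, rotation A ->
  (forall x, mpoly_eval g x = mpoly_eval f (x *m A)) -> L g = L f.

Variable L : {scalar P}.
Hypothesis LP : rotation_mean L.

Lemma mean_plane_rot (i j : 'I_n) c s f g : i != j -> c ^+ 2 + s ^+ 2 = 1 ->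
  (forall x, mpoly_eval g x =
     mpoly_eval f (plane_rot i j (c ^+ 2 - s ^+ 2) (2 * c * s) x)) -> L g = L f.
Proof.
move=> nij cs gf; apply: (LP (rotation_plane_rot nij cs)) => x.
by rewrite gf mulmxA !plane_rot_mxE plane_rot_double.
Qed.

(** Derivation under [L] is replaced by a polynomial identity. By invariance, [L] of a rotated
    monomial with denominators cleared is a power of [rat_norm] times [L] of the monomial. This
    holds for every value of the parameter, hence between polynomials; the right side has no term of
    degree 1, and the left one has 4 times the wanted value there. *)
Lemma mean_angular_deriv i j f : i != j -> L (angular_deriv i j f) = 0.
Proof.
move=> nij; have nji : (j == i) = false by rewrite eq_sym (negPf nij).
suff mon m : L (angular_deriv i j (mpolyX R m)) = 0.
  rewrite [f]mpolyE /angular_deriv !raddf_sum /= !mulr_sumr -sumrB raddf_sum /=.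
  apply: big1 => m _.
  rewrite !mderivZ -!scalerAr -scalerBr linearZ /=.
  by rewrite -[_ - _]/(angular_deriv i j (mpolyX R m)) mon mulr0.
(* [W] is the composition of the monomial [m] with the rotation of angle
   [4 * atan t], scaled to be polynomial in [t]; its coefficient in degree 1 is
   [4 * angular_deriv]. *)
pose C := rat_cos P; pose S := rat_sin P; pose M := rat_norm P.
pose lin (k : 'I_n) : {poly P} :=
  if k == i then C * (Xv i)%:P + S * (Xv j)%:P
  else if k == j then C * (Xv j)%:P - S * (Xv i)%:P else M * (Xv k)%:P.
(* First-order expansions f + 4 t D f, with D the angular derivative. As D is a derivation, they
   multiply, so it is enough to expand the coordinates. *)
pose jet (W : {poly P}) f := W`_0 = f /\ W`_1 = 4 * angular_deriv i j f.
have jetM W W' g g' : jet W g -> jet W' g' -> jet (W * W') (g * g').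
  move=> [w0 w1] [w0' w1']; split; first by rewrite coefM big_ord1 w0 w0'.
  rewrite coefM !big_ord_recl big_ord0 /= w0 w1 w0' w1' angular_derivM.
  rewrite addr0 addrC [RHS]mulrDr mulrA; congr (_ + _); exact: mulrCA.
have jet1 : jet 1 1.
  split; rewrite coef1//= /angular_deriv.
  by rewrite -mpolyC1 !mderivC !mulr0 subr0 mulr0.
have jetlin k : jet (lin k) (Xv k).
  rewrite /jet /lin /angular_deriv !mderivXU.
  have [p0 p1 q0 q1] := rat_rotation_coef (Xv i) (Xv j).
  have [n0 n1] := rat_norm_coefMC (Xv k).
  have [eki|nki] := boolP (k == i).
    by rewrite p0 p1 (eqP eki) (negPf nij) mulr0 mulr1 subr0.
  have [ekj|nkj] := boolP (k == j).
    by rewrite q0 q1 (eqP ekj) mulr0 mulr1 sub0r mulrN.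
  by rewrite n0 n1 !mulr0 subr0 mulr0.
pose W := \prod_k lin k ^+ m k.
have [_ W1] : jet W (mpolyX R m).
  rewrite mpolyXE_id; apply: (big_ind2 jet) => [//|w g w' g'|k _]; first exact: jetM.
  elim: (m k) => [|e IH]; first by rewrite !expr0.
  by rewrite !exprS; apply: jetM.
pose q := \poly_(e < size W) L W`_e.
pose u t : P := mpolyC n t.
have qE : q = rat_norm R ^+ mdeg m * (L (mpolyX R m))%:P.
  apply/eqP; rewrite -subr_eq0; apply/eqP; apply: poly_fun_eq0 => t.
  rewrite hornerD hornerN hornerM hornerC horner_exp.
  have -> : q.[t] = L W.[u t].
    rewrite horner_poly horner_coef raddf_sum /=; apply: eq_bigr => e _.
    by rewrite /u -rmorphXn /= mulrC -linearZ /= -mul_mpolyC mulrC.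
  rewrite -linearZ /=; apply/eqP; rewrite subr_eq0; apply/eqP.
  have [Ct St Mt] := rat_horner t.
  have t1 : 1 + t ^+ 2 != 0 by rewrite gt_eqF// ltr_pwDl ?sqr_ge0.
  (* These are the cosine and sine of 2 atan t; [mean_plane_rot] doubles the angle to 4 atan t. *)
  apply: (@mean_plane_rot i j ((1 - t ^+ 2) / (1 + t ^+ 2)) (2 * t / (1 + t ^+ 2))) => //.
    by field.
  move=> x; rewrite /mpoly_eval mevalZ mevalX horner_prod rmorph_prod /=.
  rewrite mdegE -prodrXr -big_split /=; apply: eq_bigr => k _.
  rewrite horner_exp rmorphXn -exprMn /=; congr (_ ^+ _).
  have mu : meval (x 0) (u t) = t by rewrite /u mevalC.
  rewrite /lin !mxE /C /S /M; case: (k == i); [|case: (k == j)].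
  - have [/= -> _ _] := rat_rotation_rmorph (meval (x 0)) (u t) (Xv i) (Xv j).
    by rewrite mu !mevalXU Ct St Mt; field.
  - have [/= _ -> _] := rat_rotation_rmorph (meval (x 0)) (u t) (Xv i) (Xv j).
    by rewrite mu !mevalXU Ct St Mt; field.
  - have [/= _ _ ->] := rat_rotation_rmorph (meval (x 0)) (u t) (Xv k) (Xv k).
    by rewrite mu !mevalXU.
have := congr1 (fun p : {poly R} => p`_1) qE.
rewrite /= coefMC rat_norm_exp_coef1 mul0r coef_poly.
(* If [W] has size at most 1, then [q] has no coefficient of degree 1, but that of [W] is 0 as well
   and the angular derivative itself vanishes. *)
case: ltnP => [_|/(nth_default 0) W10].
  rewrite W1 => /eqP; rewrite mulr_natl raddfMn /= mulrn_eq0 /=.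
  by move/eqP.
move: W1; rewrite W10 => /esym/(congr1 L); rewrite mulr_natl raddfMn raddf0 /= => /eqP.
by rewrite mulrn_eq0 => /eqP.
Qed.

End Rotated.

(** * Recurrences for the moments of the sphere *)

Section Moments.
Variables (R : realType) (n : nat).
Notation P := (mpoly n R).
Notation Xv k := (mpolyX R (mnm1 k) : mpoly n R).

(** Euler's identity, the form in which homogeneity of degree [D] is used. *)
Definition euler (D : nat) (g : P) := \sum_j Xv j * mderiv j g = D%:R * g.

Lemma eulerM D E g h : euler D g -> euler E h -> euler (D + E) (g * h).
Proof.
move=> eg eh; rewrite /euler.
under eq_bigr do rewrite mderivM mulrDr (mulrA _ _ h) (mulrCA _ g).
by rewrite big_split /= -mulr_suml -mulr_sumr eg eh natrD mulrDl -mulrA (mulrCA g).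
Qed.

Lemma euler1 : euler 0 1.
Proof.
rewrite /euler mul0r big1// => j _.
by rewrite -mpolyC1 mderivC mulr0.
Qed.

Lemma eulerXU k : euler 1 (Xv k).
Proof.
rewrite /euler (bigD1 k)//= mderivXU eqxx mulr1 mul1r big1 ?addr0// => j /negPf jk.
by rewrite mderivXU eq_sym jk mulr0.
Qed.

Lemma eulerXn D g e : euler D g -> euler (D * e) (g ^+ e).
Proof.
move=> eg; elim: e => [|e IH]; first by rewrite muln0 expr0; exact: euler1.
by rewrite mulnS exprS; apply: eulerM.
Qed.

Lemma euler_prod (I : Type) (r : seq I) (D : I -> nat) (g : I -> P) :
  (forall i, euler (D i) (g i)) -> euler (\sum_(i <- r) D i) (\prod_(i <- r) g i).
Proof.
move=> eg; elim: r => [|i r IH]; first by rewrite !big_nil; exact: euler1.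
by rewrite !big_cons; apply: eulerM.
Qed.

Lemma euler_sum (I : Type) (r : seq I) D (g : I -> P) :
  (forall i, euler D (g i)) -> euler D (\sum_(i <- r) g i).
Proof.
move=> eg; rewrite /euler mulr_sumr.
under eq_bigr do rewrite raddf_sum mulr_sumr.
by rewrite exchange_big /=; apply: eq_bigr => i _; exact: eg.
Qed.

Lemma mderivXn i (g : P) e : mderiv i (g ^+ e) = e%:R * (g ^+ e.-1 * mderiv i g).
Proof.
elim: e => [|e IH]; first by rewrite expr0 -mpolyC1 mderivC mul0r.
rewrite exprS mderivM IH -natr1 mulrDl mul1r addrC [mderiv i g * _]mulrC; congr (_ + _).
case: e {IH} => [|e]; first by rewrite !mul0r mulr0.
by rewrite mulrCA (mulrA g) -exprS.
Qed.

Definition power_sum (b : nat) : P := \sum_k Xv k ^+ (2 * b).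

Lemma euler_power_sum b : euler (2 * b) (power_sum b).
Proof. by apply: euler_sum => k; rewrite -{1}[(2 * b)%N]mul1n; apply/eulerXn/eulerXU. Qed.

Lemma mderiv_power_sum i b : mderiv i (power_sum b) = (2 * b)%:R * Xv i ^+ (2 * b).-1.
Proof.
rewrite /power_sum raddf_sum (bigD1 i)//= mderivXn mderivXU eqxx mulr1 big1 ?addr0//.
by move=> k /negPf ki; rewrite mderivXn mderivXU ki !mulr0.
Qed.

Lemma power_sum0 : power_sum 0 = n%:R.
Proof.
rewrite /power_sum; under eq_bigr do rewrite expr0.
by rewrite sumr_const card_ord.
Qed.

Definition sphere_mean_like (L : {scalar P}) := forall f g : P,
  (forall x, unit_sphere x -> mpoly_eval f x = mpoly_eval g x) -> L f = L g.

Variable L : {scalar P}.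
Hypotheses (n_gt1 : (1 < n)%N) (LP : rotation_mean L) (LS : sphere_mean_like L).

Lemma mpoly_eval_power_sum b (x : 'rV[R]_n) :
  mpoly_eval (power_sum b) x = \sum_k x 0 k ^+ (2 * b).
Proof.
rewrite /mpoly_eval rmorph_sum; apply: eq_bigr => k _.
by rewrite [LHS]rmorphXn /= mevalXU.
Qed.

Lemma mean_power_sum1 h : L (power_sum 1 * h) = L h.
Proof.
apply: LS => x sx; have := mpoly_eval_power_sum 1 x.
by rewrite sx /mpoly_eval mevalM => ->; rewrite mul1r.
Qed.

Lemma meanMn c g : L (c%:R * g) = c%:R * L g.
Proof. by rewrite mulr_natl raddfMn /= mulr_natl. Qed.

Lemma mean_mderiv i D g : euler D g ->
  L (mderiv i g) = (n%:R + D%:R - 1) * L (Xv i * g).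
Proof.
move=> eg.
have H j : j != i ->
    L (Xv j ^+ 2 * mderiv i g) - L (Xv i * g) - L (Xv i * (Xv j * mderiv j g)) = 0.
  move=> ji; have ij : i != j by rewrite eq_sym.
  rewrite -(mean_angular_deriv LP (Xv j * g) ij) /angular_deriv !mderivM !mderivXU.
  rewrite eqxx (negPf ji) mul0r add0r mul1r (mulrA (Xv j) (Xv j)) -expr2 mulrDr opprD.
  by rewrite addrA !linearB.
have : \sum_(j | j != i) (L (Xv j ^+ 2 * mderiv i g) - L (Xv i * g) -
    L (Xv i * (Xv j * mderiv j g))) = 0.
  by rewrite big1.
rewrite !sumrB sumr_const.
have -> : #|[pred j | j != i]| = n.-1 by rewrite cardC1 card_ord.
(* On the sphere the squares x_j^2 sum to 1, so only the term x_i^2 d_i g is missing. The same term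
   is missing from Euler's identity below, and the two cancel. *)
have -> : \sum_(j | j != i) L (Xv j ^+ 2 * mderiv i g) =
    L (mderiv i g) - L (Xv i ^+ 2 * mderiv i g).
  rewrite -(mean_power_sum1 (mderiv i g)) /power_sum mulr_suml raddf_sum /=.
  rewrite [in RHS](bigD1 i)//=.
  by rewrite addrAC subrr add0r.
have -> : \sum_(j | j != i) L (Xv i * (Xv j * mderiv j g)) =
    D%:R * L (Xv i * g) - L (Xv i ^+ 2 * mderiv i g).
  rewrite -meanMn mulrCA -eg mulr_sumr raddf_sum [in RHS](bigD1 i)//=.
  by rewrite mulrA -expr2 addrAC subrr add0r.
have n0 : (0 < n)%N by apply: leq_ltn_trans (ltn_ord i).
rewrite -[_ *+ n.-1]mulr_natl -subn1 natrB//.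
move=> H0; lra.
Qed.

(** This is [mean_mderiv] for x_i^(e+1) h, of degree e + 1 + D, with the product rule applied to the
    derivative. *)
Lemma mean_exp_rec i D e h : euler D h ->
  (n%:R + (e + D)%:R) * L (Xv i ^+ e.+2 * h) =
    e.+1%:R * L (Xv i ^+ e * h) + L (Xv i ^+ e.+1 * mderiv i h).
Proof.
move=> eh.
have ee : euler (1 * e.+1 + D) (Xv i ^+ e.+1 * h).
  by apply: eulerM => //; apply: eulerXn; exact: eulerXU.
have := mean_mderiv i ee; rewrite mulrA -exprS mderivM mderivXn mderivXU eqxx mulr1.
rewrite -mulrA raddfD /= meanMn => ->; congr (_ * _).
by rewrite mul1n addSn -natr1; lra.
Qed.

(** Write the monomial as a power of x_i times some [h] free of x_i. Then [mean_exp_rec] lowers the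
    exponent by 2 down to 1, where [mean_mderiv] applies with d_i h = 0. Its factor n + D - 1 is
    positive even for D = 0 because n > 1. *)
Lemma mean_odd (m : multinom n) i : odd (m i) -> L (mpolyX R m) = 0.
Proof.
move=> om.
rewrite mpolyXE_id (bigD1 i)//=; set h := (X in _ * X).
have h0 : mderiv i h = 0.
  rewrite /h; apply: (big_ind (fun f => mderiv i f = 0)) => [|f g f0 g0|k /negPf ki].
  - by rewrite -mpolyC1 mderivC.
  - by rewrite mderivM f0 g0 mul0r mulr0 addr0.
  - by rewrite mderivXn mderivXU ki !mulr0.
have eh : euler (\sum_(k | k != i) m k) h.
  rewrite /h -!(big_filter (index_enum _)); apply: euler_prod => k.
  by rewrite -{1}[m k]mul1n; apply: eulerXn; exact: eulerXU.
suff H e : L (Xv i ^+ (e.*2.+1) * h) = 0 by rewrite -(odd_double_half (m i)) om; exact: H.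
elim: e => [|e IH].
  have := mean_mderiv i eh; rewrite h0 raddf0 expr1 => /esym/eqP.
  rewrite mulf_eq0 gt_eqF ?orFb; first by move/eqP.
  by rewrite subr_gt0 ltr_wpDr ?ler0n// ltr1n.
have := mean_exp_rec i e.*2.+1 eh; rewrite h0 mulr0 raddf0 addr0 IH mulr0 => /eqP.
by rewrite mulf_eq0 gt_eqF ?ltr_wpDr ?ltr0n ?(ltnW n_gt1)// => /eqP.
Qed.

Lemma mean_power_sum_rec b D h : euler D h ->
  (n%:R + (2 * b + D)%:R) * L (power_sum b.+1 * h) =
  (2 * b).+1%:R * L (power_sum b * h) + L (\sum_i Xv i ^+ (2 * b).+1 * mderiv i h).
Proof.
move=> eh; rewrite /power_sum !mulr_suml !raddf_sum !mulr_sumr -big_split /=.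
by apply: eq_bigr => i _; rewrite mulnS (mean_exp_rec i (2 * b) eh).
Qed.

Lemma mean_power_sumS b :
  (n%:R + (2 * b)%:R) * L (power_sum b.+1) = (2 * b).+1%:R * L (power_sum b).
Proof.
have := mean_power_sum_rec b euler1; rewrite !mulr1 addn0 => ->.
rewrite [X in _ + L X]big1 ?raddf0 ?addr0// => i _.
by rewrite -mpolyC1 mderivC mulr0.
Qed.

(** In [mean_power_sum_rec] take for [h] the power sum p_c: its derivative 2c x_i^(2c-1) turns the
    last term into a multiple of p_(b+c). *)
Lemma mean_power_sumM b c :
  (n%:R + (2 * b + 2 * c)%:R) * L (power_sum b.+1 * power_sum c) =
  (2 * b).+1%:R * L (power_sum b * power_sum c) + (2 * c)%:R * L (power_sum (b + c)).
Proof.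
rewrite (mean_power_sum_rec b (euler_power_sum c)); congr (_ + _).
rewrite -meanMn /power_sum mulr_sumr; congr (L _); apply: eq_bigr => i _.
(* For c = 0 the predecessor in the exponent is truncated, but the coefficient 2c vanishes. *)
case: c => [|c]; first by rewrite mderiv_power_sum muln0 !mul0r mulr0.
rewrite mderiv_power_sum mulrCA -exprD; congr (_ * _ ^+ _).
by rewrite mulnDr mulnS addSnnS.
Qed.

Lemma mean_signed_swap (i j : 'I_n) f g : i != j ->
  (* The proof takes c = s = 1 / sqrt 2, an eighth of a turn, whose square is the quarter turn. *)
  (forall x, mpoly_eval g x = mpoly_eval f (plane_rot i j 0 1 x)) -> L g = L f.
Proof.
move=> nij gf; pose r : R := (Num.sqrt 2)^-1.
have r2 : r ^+ 2 = 2^-1 by rewrite exprVn sqr_sqrtr.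
apply: (mean_plane_rot LP nij (c := r) (s := r)); first by rewrite r2; lra.
by move=> x; rewrite subrr -mulrA -expr2 r2 divff.
Qed.

End Moments.

(** * Reduction to power sums *)

Section Uniqueness.
Variables (R : realType) (n : nat).
Notation P := (mpoly n R).
Notation Xv k := (mpolyX R (mnm1 k) : mpoly n R).

(** The sign makes the exchange of two coordinates a rotation, so that the sphere mean is invariant
    under it. *)
Definition signed_swap_invariant (F : {scalar P}) := forall (i j : 'I_n) (f g : P),
  i != j -> (forall x, mpoly_eval g x = mpoly_eval f (plane_rot i j 0 1 x)) -> F g = F f.

Variables (F : {scalar P}) (t : nat).
Hypotheses (Fswap : signed_swap_invariant F) (FS : sphere_mean_like F).
Hypothesis Fodd : forall (m : multinom n) i, odd (m i) -> F (mpolyX R m) = 0.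
Hypothesis Fps : forall cs, all (leq 2) cs -> (2 * sumn cs <= t)%N ->
  F (\prod_(b <- cs) power_sum R n b) = 0.

(** The factors of [bs] are treated one by one: p_0 is the constant n, p_1 is 1 on the sphere, and
    the others move to [cs], on which [Fps] applies at the end. *)
Lemma functional_power_sums_eq0 bs cs : all (leq 2) cs ->
  (2 * (sumn cs + sumn bs) <= t)%N ->
  F ((\prod_(b <- cs) power_sum R n b) * \prod_(b <- bs) power_sum R n b) = 0.
Proof.
elim: bs cs => [|b bs IH] cs c2; first by rewrite addn0 big_nil mulr1 => /Fps; apply.
rewrite /= => le_t; rewrite big_cons mulrCA.
case: b le_t => [|[|b]] le_t.
- by rewrite power_sum0 meanMn IH ?mulr0.
- by rewrite mean_power_sum1// IH//; lia.
- have := IH (b.+2 :: cs); rewrite big_cons -mulrA; apply => //=; lia.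
Qed.

(** Induction on [s]. With [H] the product without the factor of x_i, [F] kills [H] times the power
    sum p_(a i). Expand that power sum: a term with j in [s] merges with the factor of x_j already
    present and vanishes by induction, and all the terms with j outside [s] have the same value, the
    wanted one. *)
Lemma functional_even_eq0 (s : seq 'I_n) (a : 'I_n -> nat) bs : uniq s ->
  (2 * (sumn bs + \sum_(k <- s) a k) <= t)%N ->
  F ((\prod_(b <- bs) power_sum R n b) * \prod_(k <- s) Xv k ^+ (2 * a k)) = 0.
Proof.
elim: s a bs => [|i s IH] a bs.
  rewrite !big_nil addn0 mulr1 => _ le_t.
  by have := @functional_power_sums_eq0 bs [::] isT le_t; rewrite big_nil mul1r.
rewrite /= big_cons => /andP[nis us] le_t.
pose H := (\prod_(b <- bs) power_sum R n b) * \prod_(k <- s) Xv k ^+ (2 * a k).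
pose T j := F (Xv j ^+ (2 * a i) * H).
have Tin j : j \in s -> T j = 0.
  move=> js; pose a' k := if k == j then (a k + a i)%N else a k.
  rewrite /T /H mulrCA -[RHS](IH a' bs us).
    congr (F (_ * _)).
    rewrite (perm_big _ (perm_to_rem js)) [RHS](perm_big _ (perm_to_rem js)) /=.
    rewrite !big_cons mulrA -exprD /a' eqxx addnC -mulnDr; congr (_ * _).
    apply: eq_big_seq => k; rewrite mem_rem_uniq// inE => /andP[/negPf kj _].
    by rewrite kj.
  have a'E : (\sum_(k <- rem j s) a' k = \sum_(k <- rem j s) a k)%N.
    by apply: eq_big_seq => k; rewrite mem_rem_uniq// inE /a' => /andP[/negPf -> _].
  have a'j : a' j = (a j + a i)%N by rewrite /a' eqxx.
  move: le_t; rewrite !(perm_big _ (perm_to_rem js)) /= !big_cons a'E a'j.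
  by rewrite (addnC (a j) (a i)) -(addnA (a i)).
have Tnotin j : j \notin s -> T j = T i.
  move=> njs; have [->//|nji] := eqVneq j i; have nij : i != j by rewrite eq_sym.
  apply: (Fswap nij) => x; rewrite /mpoly_eval /H !mevalM.
  set y := plane_rot i j 0 1 x.
  have yk k : k != i -> k != j -> y 0 k = x 0 k.
    by move=> /negPf ki /negPf kj; rewrite mxE ki kj.
  have yi : y 0 i = x 0 j by rewrite mxE eqxx mul0r mul1r add0r.
  have yj : y 0 j = - x 0 i by rewrite mxE (negPf nji) eqxx mul0r mul1r sub0r.
  congr (_ * (_ * _)).
  - by rewrite !rmorphXn /= !mevalXU yi.
  - rewrite !rmorph_prod /=; apply: eq_bigr => b _.
    have := mpoly_eval_power_sum b x; have := mpoly_eval_power_sum b y.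
    rewrite /mpoly_eval => -> ->.
    (* Only the coordinate j of [y] carries a sign, and it enters through even powers. *)
    rewrite (bigD1 i)//= (bigD1 j)//= [RHS](bigD1 i)//= [in RHS](bigD1 j)//=.
    rewrite yi yj [(- _) ^+ _]exprM sqrrN -exprM addrCA.
    congr (_ + (_ + _)); apply: eq_bigr => k /andP[ki kj].
    by rewrite yk.
  - rewrite !rmorph_prod /=; apply: eq_big_seq => k ks.
    rewrite !rmorphXn /= !mevalXU yk//.
      by apply: contraNneq nis => <-.
    by apply: contraNneq njs => <-.
have : \sum_j T j = 0.
  rewrite /T -raddf_sum -mulr_suml /H mulrA.
  by have := IH a (a i :: bs) us; rewrite big_cons; apply => /=; lia.
rewrite (bigID (mem s)) /= big1 ?add0r; last by move=> j /Tin.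
rewrite (eq_bigr (fun=> T i)); last by move=> j /Tnotin.
rewrite sumr_const => /eqP; rewrite mulrn_eq0 => /orP[|/eqP Ti0].
  (* The common value is counted at least once, since i itself is outside [s]. *)
  by move=> /eqP/card0_eq/(_ i)/negbT/negP[]; exact: nis.
by rewrite big_cons mulrCA.
Qed.

Lemma functional_eq0 f : degree_le t f -> F f = 0.
Proof.
rewrite /degree_le => le_t; rewrite [f]mpolyE raddf_sum big_seq big1//= => m mf.
have mt : (mdeg m <= t)%N by rewrite -ltnS; apply: leq_trans le_t; exact: msize_mdeg_lt.
rewrite linearZ /=; case: (pickP (fun i => odd (m i))) => [i om|em].
  by rewrite (Fodd om) mulr0.
pose a i := (m i)./2.
have mE i : m i = (2 * a i)%N by rewrite mul2n -[LHS]odd_double_half em.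
have := @functional_even_eq0 (index_enum 'I_n) a [::] (index_enum_uniq _).
rewrite big_nil mul1r mpolyXE_id /= => H.
under eq_bigr do rewrite mE.
rewrite H ?mulr0//; move: mt; rewrite mdegE.
by rewrite add0n big_distrr /=; under eq_bigr do rewrite mE.
Qed.

End Uniqueness.

(** * Orbits of signed permutations *)

Section SignedPermutations.
Variables (R : realType) (n : nat).
Implicit Types (s : 'S_n) (e : {ffun 'I_n -> bool}) (x y z : 'rV[R]_n).

Definition signed_perm s e y : 'rV[R]_n := \row_i ((-1) ^+ e i * y 0 (s i)).

Lemma orbit_pointsP y z :
  reflect (exists s e, z = signed_perm s e y) (z \in orbit_points y).
Proof.
rewrite mem_undup; apply: (iffP allpairsP) => [[[s e] [_ _ ->]]|[s [e ->]]].
  by exists s, e.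
by exists (s, e); rewrite !mem_enum.
Qed.

Lemma orbit_points_refl y : y \in orbit_points y.
Proof.
apply/orbit_pointsP; exists 1%g, [ffun=> false].
by apply/rowP => i; rewrite mxE ffunE perm1 mul1r.
Qed.

Lemma size_orbit_points_gt0 y : (0 < size (orbit_points y))%N.
Proof. by have := orbit_points_refl y; case: (orbit_points y). Qed.

Lemma signed_perm_orbit s e y z : z \in orbit_points y ->
  signed_perm s e z \in orbit_points y.
Proof.
move=> /orbit_pointsP[s' [e' ->]]; apply/orbit_pointsP.
exists (s * s')%g, [ffun i => e i (+) e' (s i)].
by apply/rowP => i; rewrite !mxE ffunE permM signr_addb mulrA.
Qed.

Lemma signed_perm_inj s e : injective (signed_perm s e).
Proof.
move=> x y /rowP xy; apply/rowP => i; have := xy ((s^-1)%g i).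
by rewrite !mxE permKV => /(mulfI (negbT (signr_eq0 _ _))).
Qed.

(** A signed permutation maps the duplicate-free list of the orbit injectively into itself, hence
    permutes it. *)
Lemma sum_orbit_signed_perm s e (h : 'rV[R]_n -> R) y :
  \sum_(z <- orbit_points y) h (signed_perm s e z) = \sum_(z <- orbit_points y) h z.
Proof.
rewrite -(big_map (signed_perm s e) xpredT h); apply: perm_big.
have uo : uniq (orbit_points y) by exact: undup_uniq.
have um : uniq (map (signed_perm s e) (orbit_points y)).
  by rewrite map_inj_uniq//; exact: signed_perm_inj.
apply: uniq_perm => //.
have [|//|] := uniq_min_size um (s2 := orbit_points y); last by [].
  by move=> _ /mapP[z zy ->]; exact: signed_perm_orbit.
by rewrite size_map.
Qed.

(** The quarter turn is both a rotation and a signed permutation, hence a symmetry of the sphere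
    mean and of the orbit averages. *)
Lemma plane_rot_signed_perm (i j : 'I_n) x : i != j ->
  plane_rot i j 0 1 x = signed_perm (tperm i j) [ffun k => k == j] x.
Proof.
move=> nij; apply/rowP => k; rewrite !mxE ffunE.
case: tpermP => [->|->|/eqP/negPf -> /eqP/negPf ->].
- by rewrite eqxx (negPf nij) mul0r add0r !mul1r.
- by rewrite eqxx eq_sym (negPf nij) mul0r sub0r mul1r mulN1r.
- by rewrite mul1r.
Qed.

Lemma orbit_average_signed_perm s e (f g : mpoly n R) y :
  (forall x, mpoly_eval g x = mpoly_eval f (signed_perm s e x)) ->
  orbit_average g y = orbit_average f y.
Proof.
move=> gf; rewrite /orbit_average -(sum_orbit_signed_perm s e (mpoly_eval f)).
congr (_ / _).
by apply: eq_bigr => z _; exact: gf.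
Qed.

Lemma orbit_average_const (f : mpoly n R) c y :
  (forall z, z \in orbit_points y -> mpoly_eval f z = c) -> orbit_average f y = c.
Proof.
move=> fc; rewrite /orbit_average (eq_big_seq (fun=> c))//.
rewrite big_const_seq count_predT iter_addr_0 -[c *+ _]mulr_natr mulfK//.
by rewrite pnatr_eq0 -lt0n size_orbit_points_gt0.
Qed.

Lemma orbit_average_is_scalar y : scalar (fun f : mpoly n R => orbit_average f y).
Proof.
move=> c f g; rewrite /orbit_average mulrA -mulrDl mulr_sumr -big_split /=.
by congr (_ / _); apply: eq_bigr => z _; rewrite /mpoly_eval mevalD mevalZ.
Qed.

(** Changing the sign of x_i negates the monomial and preserves the orbit, so the average equals its
    opposite. *)
Lemma orbit_average_odd (m : multinom n) i y : odd (m i) ->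
  orbit_average (mpolyX R m) y = 0.
Proof.
move=> om; have H x : mpoly_eval (- mpolyX R m) x =
    mpoly_eval (mpolyX R m) (signed_perm 1%g [ffun k => k == i] x).
  rewrite /mpoly_eval mevalN !mevalX (bigD1 i)//= [RHS](bigD1 i)//= -mulNr.
  rewrite mxE ffunE eqxx perm1 mulN1r exprNn -signr_odd om mulN1r; congr (_ * _).
  by apply: eq_bigr => k /negPf ki; rewrite mxE ffunE ki perm1 mul1r.
have := orbit_average_signed_perm y H.
have := orbit_average_is_scalar y (-1) (mpolyX R m) 0.
rewrite addr0 scaleN1r => ->.
have -> : orbit_average 0 y = 0.
  by apply: orbit_average_const => z _; rewrite /mpoly_eval meval0.
move=> H2; lra.
Qed.

Definition even_power_sum (b : nat) y : R := \sum_k y 0 k ^+ (2 * b).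

Lemma even_power_sum_orbit b y z : z \in orbit_points y ->
  even_power_sum b z = even_power_sum b y.
Proof.
move=> /orbit_pointsP[s [e ->]]; rewrite /even_power_sum [RHS](reindex_perm s) /=.
apply: eq_bigr => k _; rewrite mxE exprMn -exprM mulnCA exprM.
by rewrite sqrrN !expr1n mul1r.
Qed.

Lemma orbit_average_power_sums cs y :
  orbit_average (\prod_(b <- cs) power_sum R n b) y = \prod_(b <- cs) even_power_sum b y.
Proof.
apply: orbit_average_const => z zy.
rewrite /mpoly_eval rmorph_prod /=; apply: eq_bigr => b _.
by rewrite -(even_power_sum_orbit b zy) /even_power_sum -mpoly_eval_power_sum.
Qed.

Lemma unit_sphere_orbit y z : z \in orbit_points y -> unit_sphere y -> unit_sphere z.
Proof.
move=> zy; rewrite /unit_sphere /= => y1.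
by have := even_power_sum_orbit 1 zy; rewrite /even_power_sum y1.
Qed.

End SignedPermutations.

(** * The moment equations of a rule with six orbits *)

Section OrbitRule.
Variables (R : realType) (n : nat).
Notation borel := (borel_rV R n).

Definition cubature_error (sigma : probability borel R) (Y : 'I_6 -> 'rV[R]_n)
    (l : 'I_6 -> R) (f : mpoly n R) : R :=
  sphere_mean sigma f - \sum_(i < 6) l i * orbit_average f (Y i).

Lemma cubature_error_is_scalar sigma Y l : scalar (cubature_error sigma Y l).
Proof.
move=> c f g; rewrite /cubature_error linearP /=.
under eq_bigr do rewrite orbit_average_is_scalar mulrDr mulrCA.
by rewrite big_split /= -mulr_sumr; ring.
Qed.

HB.instance Definition _ sigma Y l := GRing.isLinear.Build R (mpoly n R) R *%R
  (cubature_error sigma Y l) (cubature_error_is_scalar sigma Y l).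

Hypothesis n_gt1 : (1 < n)%N.

(** The numbers [s2], [s3], [s4] are the sphere means of p_2, p_3, p_4, obtained from p_1 = 1 by
    [mean_power_sumS]. The means of p_2^2 and p_2 p_3 come from [mean_power_sumM] at b = 1, where
    p_1 p_c and p_c agree on the sphere. *)
Lemma orbit_rule11 (Y : 'I_6 -> 'rV[R]_n) (l : 'I_6 -> R) :
  \sum_(i < 6) l i = 1 -> (forall i, unit_sphere (Y i)) ->
  let p b i := even_power_sum b (Y i) in
  let s2 := 3 / (n%:R + 2) in
  let s3 := 5 * s2 / (n%:R + 4) in
  let s4 := 7 * s3 / (n%:R + 6) in
  [/\ \sum_(i < 6) l i * p 2%N i = s2, \sum_(i < 6) l i * p 3%N i = s3,
      \sum_(i < 6) l i * p 4%N i = s4 & \sum_(i < 6) l i * p 5%N i = 9 * s4 / (n%:R + 8)] ->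
  \sum_(i < 6) l i * (p 2%N i * p 2%N i) = (3 * s2 + 4 * s3) / (n%:R + 6) ->
  \sum_(i < 6) l i * (p 2%N i * p 3%N i) = (3 * s3 + 6 * s4) / (n%:R + 8) ->
  orbit_rule 11 Y l.
Proof.
move=> l1 Y1 p s2 s3 s4 [E2 E3 E4 E5] E22 E23 sigma sigmaP f f11.
rewrite sphere_integralE; congr EFin; apply/eqP; rewrite -subr_eq0; apply/eqP.
rewrite -[LHS]/(cubature_error sigma Y l f).
have LP : rotation_mean (sphere_mean sigma) := sphere_mean_rotation sigmaP.
have LS : sphere_mean_like (sphere_mean sigma) := @eq_sphere_mean _ _ sigma.
have L1 := sphere_mean1 sigmaP.
apply: (functional_eq0 (F := cubature_error sigma Y l) _ _ _ _ f11).
- move=> i j g h nij hg; rewrite /= /cubature_error; congr (_ - _).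
    exact: (mean_signed_swap LP nij).
  apply: eq_bigr => k _; congr (_ * _).
  apply: (@orbit_average_signed_perm _ _ (tperm i j) [ffun k => k == j]) => x.
  by rewrite hg plane_rot_signed_perm.
- move=> g h gh; rewrite /= /cubature_error; congr (_ - _); first exact: LS.
  apply: eq_bigr => k _; congr (_ * _); rewrite /orbit_average; congr (_ / _).
  by apply: eq_big_seq => z zY; apply: gh; apply: unit_sphere_orbit zY _.
- move=> m i om; rewrite /= /cubature_error (mean_odd n_gt1 LP LS om) big1 ?subr0//.
  by move=> k _; rewrite (orbit_average_odd _ om) mulr0.
move=> cs c2 le_t; rewrite /= /cubature_error.
rewrite (eq_bigr (fun i => l i * \prod_(b <- cs) even_power_sum b (Y i))); last first.
  by move=> i _; congr (_ * _); exact: orbit_average_power_sums.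
have n0 e : n%:R + e%:R != 0 :> R by rewrite gt_eqF// ltr_wpDr ?ler0n// ltr0n ltnW.
have S b : sphere_mean sigma (power_sum R n b.+1) =
    (2 * b).+1%:R * sphere_mean sigma (power_sum R n b) / (n%:R + (2 * b)%:R).
  by apply: (mulfI (n0 (2 * b)%N)); rewrite (mean_power_sumS LP LS) [RHS]mulrC divfK.
have ps1 : sphere_mean sigma (power_sum R n 1) = 1.
  by rewrite -(mean_power_sum1 LS 1) mulr1 in L1 *.
have S2 : sphere_mean sigma (power_sum R n 2) = s2 by rewrite S ps1 mulr1.
have S3 : sphere_mean sigma (power_sum R n 3) = s3 by rewrite S S2.
have S4 : sphere_mean sigma (power_sum R n 4) = s4 by rewrite S S3.
have M c : sphere_mean sigma (power_sum R n 2 * power_sum R n c) =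
    (3 * sphere_mean sigma (power_sum R n c) +
     (2 * c)%:R * sphere_mean sigma (power_sum R n c.+1)) / (n%:R + (2 + 2 * c)%:R).
  apply: (mulfI (n0 (2 + 2 * c)%N)).
  rewrite -(mean_power_sum1 LS (power_sum R n c)).
  by rewrite (mean_power_sumM LP LS 1) [RHS]mulrC divfK.
(* Indices are at least 2 and their sum is at most 5: three factors would already have degree 12. *)
case: cs c2 le_t => [|b [|c [|e cs]]] /=.
- move=> _ _; rewrite big_nil L1.
  by under eq_bigr do rewrite big_nil mulr1; rewrite l1 subrr.
- move=> /andP[b2 _] le_t; rewrite big_seq1.
  under eq_bigr do rewrite big_seq1.
  have : b \in [:: 2; 3; 4; 5]%N by rewrite !inE; lia.
  rewrite !inE => /or4P[] /eqP ->; rewrite -/(p _ _).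
  + by rewrite S2 E2 subrr.
  + by rewrite S3 E3 subrr.
  + by rewrite S4 E4 subrr.
  + by rewrite S S4 E5 subrr.
- move=> /and3P[b2 c2 _] le_t; rewrite !big_cons big_nil mulr1.
  under eq_bigr do rewrite !big_cons big_nil mulr1.
  have : (b, c) \in [:: (2, 2); (2, 3); (3, 2)]%N by rewrite !inE !xpair_eqE; lia.
  rewrite !inE !xpair_eqE => /or3P[] /andP[/eqP -> /eqP ->].
  + by rewrite M S2 S3 E22 subrr.
  + by rewrite M S3 S4 E23 subrr.
  + rewrite mulrC M S3 S4 -E23; apply/eqP; rewrite subr_eq0; apply/eqP.
    by apply: eq_bigr => i _; rewrite [X in _ * X]mulrC.
- by move=> /and4P[b2 c2 e2 _] le_t; exfalso; lia.
Qed.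

End OrbitRule.

(** * From weighted orbits to nodes with positive weights *)

Section PositiveCubature.
Variables (R : realType) (n : nat).

Lemma rule_nodesP (Y : 'I_6 -> 'rV[R]_n) l x :
  reflect (exists2 i, l i != 0 & x \in orbit_points (Y i)) (x \in rule_nodes Y l).
Proof.
rewrite mem_undup; apply: (iffP flatten_mapP) => [[i]|[i li xi]].
  by rewrite mem_filter => /andP[li _] xi; exists i.
by exists i; rewrite // mem_filter li mem_enum.
Qed.

Lemma orbit_rule_positive_cubature t (Y : 'I_6 -> 'rV[R]_n) l :
  (forall i, unit_sphere (Y i)) -> convex_weights l -> orbit_rule t Y l ->
  positive_cubature t (rule_nodes Y l) (rule_weight Y l).
Proof.
move=> Y1 [l0 _] rl; split.
- exact: undup_uniq.
- by move=> x /rule_nodesP[i _ xi]; apply: unit_sphere_orbit xi _.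
- move=> x /rule_nodesP[i li xi]; rewrite /rule_weight (bigD1 i)//=.
  rewrite ltr_pwDl ?divr_gt0 ?ltr0n ?size_orbit_points_gt0//; first by rewrite lt_def li l0.
  by apply: sumr_ge0 => j _; rewrite divr_ge0.
move=> sigma sP f ft; rewrite (rl _ sP _ ft); congr EFin.
under [RHS]eq_bigr do rewrite /rule_weight mulr_suml.
rewrite (exchange_big_dep xpredT) //=; apply: eq_bigr => i _.
(* Points of an omitted orbit need not be nodes, but then both sides vanish. Otherwise the nodes in
   the orbit are all its points. *)
have [li|li] := eqVneq (l i) 0.
  by rewrite li mul0r big1// => x _; rewrite !mul0r.
rewrite -mulr_sumr -mulrA; congr (_ * _); rewrite mulrC; congr (_ * _).
rewrite -[RHS]big_filter; apply: perm_big; apply: uniq_perm.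
- exact: undup_uniq.
- by rewrite filter_uniq// undup_uniq.
move=> x; rewrite mem_filter; case: (boolP (x \in orbit_points (Y i))) => //= xi.
by apply/esym/rule_nodesP; exists i.
Qed.

End PositiveCubature.

(** * Power sums of the orbit representatives *)

Section Representatives.
Variables (R : realType) (d : nat).

(** The exponent is a successor because the zero coordinates would each contribute 1 to the power
    sum of exponent 0. *)
Lemma even_power_sum_vones k b : (0 < k <= d.+1)%N ->
  even_power_sum b.+1 ((Num.sqrt k%:R)^-1 *: vones R d k) = k%:R * k%:R^-1 ^+ b.+1.
Proof.
move=> /andP[k0 kd]; rewrite /even_power_sum.
transitivity (\sum_(j < d.+1 | (j < k)%N) (k%:R : R)^-1 ^+ b.+1).
  rewrite [RHS]big_mkcond; apply: eq_bigr => j _; rewrite !mxE exprM [(_ * _) ^+ 2]exprMn.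
  rewrite [_^-1 ^+ 2]exprVn sqr_sqrtr ?ler0n//.
  case: ifP => _; first by rewrite expr1n mulr1.
  by rewrite expr0n mulr0 expr0n.
by rewrite -(big_ord_widen d.+1 (fun=> k%:R^-1 ^+ b.+1) kd) sumr_const card_ord mulr_natl.
Qed.

Lemma even_power_sum_last_vector (a : R) p b : 0 <= a -> (0 < p <= d)%N ->
  even_power_sum b.+1 ((Num.sqrt (a + p%:R))^-1 *: last_vector d a p) =
  (a / (a + p%:R)) ^+ b.+1 + p%:R * (a + p%:R)^-1 ^+ b.+1.
Proof.
move=> a0 /andP[p0 pd]; have ap : 0 <= a + p%:R by rewrite addr_ge0.
rewrite /even_power_sum big_ord_recl; congr (_ + _).
  by rewrite !mxE eqxx exprM [(_ * _) ^+ 2]exprMn [_^-1 ^+ 2]exprVn !sqr_sqrtr// mulrC.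
transitivity (\sum_(j < d | (j < p)%N) (a + p%:R)^-1 ^+ b.+1).
  rewrite [RHS]big_mkcond; apply: eq_bigr => j _; rewrite !mxE exprM [(_ * _) ^+ 2]exprMn.
  rewrite [_^-1 ^+ 2]exprVn sqr_sqrtr//= /bump add1n.
  case: ifP => _; first by rewrite expr1n mulr1.
  by rewrite expr0n mulr0 expr0n.
by rewrite -(big_ord_widen d (fun=> (a + p%:R)^-1 ^+ b.+1) pd) sumr_const card_ord mulr_natl.
Qed.

End Representatives.

(** * Rational weights *)

Local Notation Q0 := (Qmake Z0 xH).
Local Notation Q1 := (Qmake (Zpos xH) xH).

Section RationalArithmetic.
Variable F : numFieldType.

Definition of_Z (z : Z) : F := (int_of_Z z)%:~R.

Lemma of_ZD a b : of_Z (Z.add a b) = of_Z a + of_Z b.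
Proof. by rewrite /of_Z (rmorphD int_of_Z a b : int_of_Z (Z.add a b) = _) intrD. Qed.

Lemma of_ZM a b : of_Z (Z.mul a b) = of_Z a * of_Z b.
Proof. by rewrite /of_Z (rmorphM int_of_Z a b : int_of_Z (Z.mul a b) = _) intrM. Qed.

(** Fractions of binary integers evaluate quickly under [vm_compute]; [of_Q] carries the identities
    checked there to a numeric field. *)
Definition of_Q (q : Q) : F := of_Z (Qnum q) / of_Z (Zpos (Qden q)).

Lemma of_Z_pos_gt0 p : 0 < of_Z (Zpos p).
Proof. by rewrite /of_Z /= ltr0n; apply/ssrnat.ltP/Pos2Nat.is_pos. Qed.

Lemma of_QD a b : of_Q (Qplus a b) = of_Q a + of_Q b.
Proof.
case: a b => [a1 a2] [b1 b2]; rewrite /of_Q /= Pos2Z.inj_mul of_ZD !of_ZM.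
have := of_Z_pos_gt0 a2; have := of_Z_pos_gt0 b2 => /lt0r_neq0 h2 /lt0r_neq0 h1.
by field; rewrite h1 h2.
Qed.

Lemma of_QM a b : of_Q (Qmult a b) = of_Q a * of_Q b.
Proof.
case: a b => [a1 a2] [b1 b2]; rewrite /of_Q /= Pos2Z.inj_mul !of_ZM.
have := of_Z_pos_gt0 a2; have := of_Z_pos_gt0 b2 => /lt0r_neq0 h2 /lt0r_neq0 h1.
by field; rewrite h1 h2.
Qed.

Lemma of_Z_opp a : of_Z (Z.opp a) = - of_Z a.
Proof. by apply/eqP; rewrite -addr_eq0 -of_ZD Z.add_opp_diag_l. Qed.

Lemma of_QN a : of_Q (Qopp a) = - of_Q a.
Proof. by case: a => a1 a2; rewrite /of_Q /= of_Z_opp mulNr. Qed.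

Lemma of_QV a : of_Q (Qinv a) = (of_Q a)^-1.
Proof.
case: a => [[|a1|a1] a2]; rewrite /of_Q /= ?invf_div//.
  (* Both inverses send 0 to 0. *)
  by rewrite (_ : of_Z Z0 = 0)// mul0r invr0 mulr0.
by rewrite -!Pos2Z.opp_pos !of_Z_opp invrN mulrN mulNr.
Qed.

Lemma eq_of_Q a b : Qeq_bool a b -> of_Q a = of_Q b.
Proof.
move=> /Qeq_bool_iff; case: a b => [a1 a2] [b1 b2]; rewrite /Qeq /of_Q /= => /(congr1 of_Z).
rewrite !of_ZM => ab; apply/eqP; rewrite eqr_div ?lt0r_neq0 ?of_Z_pos_gt0//.
by rewrite ab.
Qed.

Lemma of_Q_ge0 a : Qle_bool Q0 a -> 0 <= of_Q a.
Proof.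
case: a => [a1 a2]; rewrite /Qle_bool /= Z.mul_1_r => a0; apply: divr_ge0.
  by case: a1 a0 => //= a1 _; rewrite /of_Z /= ler0n.
exact/ltW/of_Z_pos_gt0.
Qed.

Definition Q_of_nat (n : nat) := Qmake (Z.of_nat n) xH.

Lemma of_Q_nat n : of_Q (Q_of_nat n) = n%:R.
Proof. by rewrite /of_Q /of_Z /= divr1; case: n => //= n; rewrite SuccNat2Pos.id_succ. Qed.

Definition Q_exp q n := iter n (Qmult q) Q1.

Lemma of_Q1 : of_Q Q1 = 1.
Proof. by rewrite /of_Q divff// lt0r_neq0// of_Z_pos_gt0. Qed.

Lemma of_Q_exp q n : of_Q (Q_exp q n) = of_Q q ^+ n.
Proof. by elim: n => [|n IH]; rewrite ?expr0 ?of_Q1//= of_QM IH exprS. Qed.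

Definition Q_dot (ls : seq Q) (x : nat -> Q) :=
  foldr Qplus Q0 [seq Qmult (nth Q0 ls i) (x i) | i <- iota 0 6].

Lemma of_Q0 : of_Q Q0 = 0.
Proof. by rewrite /of_Q /of_Z mul0r. Qed.

Lemma of_Q_dot ls x :
  of_Q (Q_dot ls x) = \sum_(i < 6) of_Q (nth Q0 ls i) * of_Q (x i).
Proof.
rewrite /Q_dot /= !of_QD !of_QM of_Q0.
by rewrite !big_ord_recl big_ord0.
Qed.

End RationalArithmetic.

Lemma ratr_of_Q (F : numFieldType) q : ratr (of_Q rat q) = of_Q F q.
Proof. by rewrite /of_Q /of_Z fmorph_div !rmorph_int. Qed.

(* In [ring_scope] a numeral of type Z would be read in unary, as 1 *+ n. *)
Declare Scope frac_scope.
Delimit Scope frac_scope with frac.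
Number Notation Z Z.of_num_int Z.to_num_int : frac_scope.
Definition frac (n d : Z) : Q := Qmake n (Z.to_pos d).
Arguments frac n%_frac d%_frac.

(* The solutions of the moment equations, in the order of [triples]; they are
   unique except for [d = 3], where v_m and v_{d+1} coincide. *)
Definition weight_table : seq (seq Q) := [::
  [:: frac 2 15; frac 1 15; frac 1 8;
      frac 0 1; frac 0 1; frac 27 40];
  [:: frac 27 280; frac 19 840; frac 1 14;
      frac 27 896; frac 16 189; frac 2401 3456];
  [:: frac 32 315; frac 1 105; frac 2 45;
      frac 0 1; frac 2 15; frac 32 45];
  [:: frac 625 7056; frac 47 10080; frac 1 42;
      frac 27 784; frac 625 5376; frac 6561 8960];
  [:: frac 13 147; frac 361 145152; frac 143 9072;
      frac 55 2688; frac 116875 1016064; frac 6875 9072];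
  [:: frac 2401 29040; frac 421 295680; frac 13 1188;
      frac 351 30976; frac 8125 76032; frac 190333 241920];
  [:: frac 1024 14157; frac 1 1152; frac 1 132;
      frac 63 9152; frac 4375 46464; frac 9 11];
  [:: frac 21627 371800; frac 4201 7413120; frac 17 3510;
      frac 357 57200; frac 252875 3212352; frac 485537 570240];
  [:: frac 6250 153153; frac 129 320320; frac 19 8008;
      frac 4617 544544; frac 11875 192192; frac 45619 51480];
  [:: frac 14641 705432; frac 61 192192; frac 0 1;
      frac 405 31616; frac 625 14144; frac 16875 18304];
  [:: frac 0 1; frac 1 4095; frac 0 1;
      frac 0 1; frac 506 12285; frac 11776 12285];
  [:: frac 625 9009; frac 860 27027; frac 1088 9009;
      frac 2700 17017; frac 40448 441441; frac 913952 1731807];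
  [:: frac 2401 28080; frac 805 61776; frac 136 2145;
      frac 135 2288; frac 3968 19305; frac 6561 11440];
  [:: frac 277749 4108390; frac 886833 143793650; frac 17216 560235;
      frac 159516 2054195; frac 926625 4519229; frac 85525504 139564425];
  [:: frac 638391523 7933086720; frac 18884159 5949815040; frac 31726 1549431;
      frac 6325047 176290816; frac 27731875 132218112; frac 81450625 125259264];
  [:: frac 806591201 9598758960; frac 91489081 52793174280; frac 9510176 599922435;
      frac 3142557 399948290; frac 22928125 112926576; frac 4408992 6413165];
  [:: frac 118869375 1912878352; frac 276450313 248674185760; frac 300044 51237813;
      frac 8664903 273268336; frac 14873196 85396355; frac 671898241 926736096];
  [:: frac 9437873 164038875; frac 93134 134213625; frac 65792 14912625;
      frac 864 43225; frac 1206144 7811375; frac 819200 1073709];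
  [:: frac 1717239817 35935972800; frac 3330379 7342686750; frac 9456 2879485;
      frac 483327 36857408; frac 125428176 935832625; frac 31381059609 39160996000];
  [:: frac 73489808 2163331125; frac 18522391 58974287625; frac 5125936 2336397615;
      frac 845386 86533245; frac 81961136 721110375; frac 2829124000 3367635183];
  [:: frac 71527079759 4245415664400; frac 1232770879 5244336997200; frac 16210172 15608145825;
      frac 83019783 9249271600; frac 36838956 393094043; frac 148733980571 169172161200]].

(* [kones_Q k] and [last_Q a p] give the sums of the [2b]-th powers of the
   coordinates of [v_k / sqrt k] and of the last representative. *)
Definition kones_Q (k b : nat) : Q :=
  Qmult (Q_of_nat k) (Q_exp (Qinv (Q_of_nat k)) b).

Definition last_Q (a : Q) (p b : nat) : Q :=
  let ap := Qinv (Qplus a (Q_of_nat p)) in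
  Qplus (Q_exp (Qmult a ap) b) (Qmult (Q_of_nat p) (Q_exp ap b)).

Definition apar_Q (d p : nat) : Q :=
  Qplus (Qmult (Qmult (Q_of_nat 10) (Qplus (Q_of_nat p) (Qopp Q1)))
           (Qinv (Qplus (Q_of_nat d) (Qopp Q1)))) (Qopp Q1).

Definition power_sum_Q (d p m b i : nat) : Q :=
  nth Q0 [:: kones_Q d.+1 b; kones_Q 1 b; kones_Q 2 b; kones_Q 3 b; kones_Q m b;
             last_Q (apar_Q d p) p b] i.

(** Decidable form of the hypotheses of [orbit_rule11] for n = d + 1, together with the bounds that
    place the representatives on the sphere and the nonnegativity of the weights. *)
Definition moments_check (d p m : nat) (ls : seq Q) : bool :=
  let P := power_sum_Q d p m in
  let q := Q_of_nat in
  let over x k := Qmult x (Qinv (q (d.+1 + k)%N)) in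
  let s2 := over (q 3%N) 2%N in
  let s3 := over (Qmult (q 5%N) s2) 4%N in
  let s4 := over (Qmult (q 7%N) s3) 6%N in
  let eqdot x s := Qeq_bool (Q_dot ls x) s in
  [&& (2 < d)%N, (0 < p <= d)%N, (0 < m <= d.+1)%N, Qle_bool Q0 (apar_Q d p),
      all (Qle_bool Q0) ls, eqdot (fun=> Q1) Q1,
      eqdot (P 2%N) s2, eqdot (P 3%N) s3, eqdot (P 4%N) s4,
      eqdot (P 5%N) (over (Qmult (q 9%N) s4) 8%N),
      eqdot (fun i => Qmult (P 2%N i) (P 2%N i))
        (over (Qplus (Qmult (q 3%N) s2) (Qmult (q 4%N) s3)) 6%N) &
      eqdot (fun i => Qmult (P 2%N i) (P 3%N i))
        (over (Qplus (Qmult (q 3%N) s3) (Qmult (q 6%N) s4)) 8%N)].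

Definition triple_weights (t : nat * nat * nat) := nth [::] weight_table (index t triples).

Lemma moments_check_triples :
  all (fun t => moments_check t.1.1 t.1.2 t.2 (triple_weights t)) triples.
Proof. by vm_compute. Qed.

Definition real_weights (F : numFieldType) (ls : seq Q) : 'I_6 -> F :=
  fun i => of_Q F (nth Q0 ls i).

(** * Transfer of the rational computations to the real rules *)

Section RepresentativesRule.
Variables (R : realType) (d p m : nat).
Notation Y := (representatives R d p m).

Lemma of_Q_apar : of_Q R (apar_Q d p) = apar R d p.
Proof. by rewrite /apar_Q !(of_QD, of_QM, of_QN, of_QV, of_Q_nat, of_Q1). Qed.

Lemma of_Q_kones k b : of_Q R (kones_Q k b) = k%:R * k%:R^-1 ^+ b.
Proof. by rewrite /kones_Q !(of_QM, of_Q_exp, of_QV, of_Q_nat). Qed.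

Hypotheses (d_gt2 : (2 < d)%N) (p_bound : (0 < p <= d)%N) (m_bound : (0 < m <= d.+1)%N).
Hypothesis a_ge0 : 0 <= apar R d p.

Lemma even_power_sum_representatives b i :
  even_power_sum b.+1 (Y i) = of_Q R (power_sum_Q d p m b.+1 i).
Proof.
case: i => [[|[|[|[|[|[|//]]]]]] i6]; rewrite /representatives /power_sum_Q /=.
- by rewrite of_Q_kones even_power_sum_vones// ltnSn.
(* The representative v_1 is not rescaled, so the factor 1 / sqrt 1 is put in first. *)
- by rewrite of_Q_kones -(@even_power_sum_vones R d 1 b isT) sqrtr1 invr1 scale1r.
- by rewrite of_Q_kones even_power_sum_vones//= ltnS (ltnW (ltnW d_gt2)).
- by rewrite of_Q_kones even_power_sum_vones//= ltnS (ltnW d_gt2).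
- by rewrite of_Q_kones even_power_sum_vones.
- rewrite even_power_sum_last_vector// /last_Q.
  by rewrite !(of_QD, of_QM, of_Q_exp, of_QV, of_Q_nat, of_Q_apar).
Qed.

Lemma representatives_sphere i : unit_sphere (Y i).
Proof.
(* The equation of the sphere is p_1 = 1 up to conversion. *)
suff : even_power_sum 1 (Y i) = 1 by [].
case: i => [[|[|[|[|[|[|//]]]]]] i6]; rewrite even_power_sum_representatives /power_sum_Q /=;
  try by rewrite of_Q_kones expr1 divff// pnatr_eq0 -lt0n//; case/andP: m_bound.
rewrite /last_Q !(of_QD, of_QM, of_Q_exp, of_QV, of_Q_nat, of_Q_apar) !expr1.
rewrite -mulrDl divff// gt_eqF// ltr_wpDl// ltr0n.
by case/andP: p_bound.
Qed.

End RepresentativesRule.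

Lemma moments_check_rule (R : realType) (d p m : nat) ls : moments_check d p m ls ->
  [/\ forall i, unit_sphere (representatives R d p m i),
      convex_weights (real_weights R ls) &
      orbit_rule 11 (representatives R d p m) (real_weights R ls)].
Proof.
case/and5P => d2 pd md a0 /and5P[l0 l1 e2 e3] /and4P[e4 e5 e22 e23].
have a_ge0 : 0 <= apar R d p by rewrite -of_Q_apar of_Q_ge0.
have sumE (x : nat -> Q) :
    \sum_(i < 6) real_weights R ls i * of_Q R (x i) = of_Q R (Q_dot ls x).
  by rewrite of_Q_dot.
have eqE (x : nat -> Q) s : Qeq_bool (Q_dot ls x) s ->
    \sum_(i < 6) real_weights R ls i * of_Q R (x i) = of_Q R s.
  by rewrite sumE; exact: eq_of_Q.
have Y1 := representatives_sphere d2 pd md a_ge0.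
have w1 : \sum_i real_weights R ls i = 1.
  rewrite -(of_Q1 R) -(eqE _ _ l1); apply: eq_bigr => i _.
  by rewrite of_Q1 mulr1.
split => //.
  split => // i; rewrite /real_weights; have [il|il] := ltnP i (size ls).
    by apply: of_Q_ge0; exact: (all_nthP Q0 l0).
  (* Entries beyond the end of [ls] are read as 0. *)
  by rewrite nth_default// of_Q0.
have pE b i := even_power_sum_representatives d2 pd md a_ge0 b i.
apply: orbit_rule11 => //.
- by rewrite ltnS (ltnW (ltnW d2)).
- split.
  + under eq_bigr do rewrite pE.
    by rewrite (eqE _ _ e2) !(of_QD, of_QM, of_QV, of_Q_nat) natrD.
  + under eq_bigr do rewrite pE.
    by rewrite (eqE _ _ e3) !(of_QD, of_QM, of_QV, of_Q_nat) !natrD.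
  + under eq_bigr do rewrite pE.
    by rewrite (eqE _ _ e4) !(of_QD, of_QM, of_QV, of_Q_nat) !natrD.
  + under eq_bigr do rewrite pE.
    by rewrite (eqE _ _ e5) !(of_QD, of_QM, of_QV, of_Q_nat) !natrD.
- under eq_bigr do rewrite !pE -of_QM.
  by rewrite (eqE _ _ e22) !(of_QD, of_QM, of_QV, of_Q_nat) !natrD.
- under eq_bigr do rewrite !pE -of_QM.
  by rewrite (eqE _ _ e23) !(of_QD, of_QM, of_QV, of_Q_nat) !natrD.
Qed.

Lemma triples_rule (R : realType) (d p m : nat) : (d, p, m) \in triples ->
  [/\ forall i, unit_sphere (representatives R d p m i),
      convex_weights (real_weights R (triple_weights (d, p, m))) &
      orbit_rule 11 (representatives R d p m) (real_weights R (triple_weights (d, p, m)))].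
Proof. by move=> /(allP moments_check_triples) H; exact: moments_check_rule. Qed.

(** Links a tabulated fraction to the numeral quotients of the three explicit rules. *)
Lemma of_Q_fracE (F : numFieldType) (n d : nat) (q : Q) :
  Qeq_bool q (Qmult (Q_of_nat n) (Qinv (Q_of_nat d))) -> of_Q F q = n%:R / d%:R.
Proof. by move=> /eq_of_Q ->; rewrite of_QM of_QV !of_Q_nat. Qed.

Theorem mainTheorem8 (R : realType) :
  (forall d p m : nat, (d, p, m) \in triples ->
     exists l : 'I_6 -> R,
       convex_weights l /\ orbit_rule 11 (representatives R d p m) l)
  /\
  (forall d : nat, (3 <= d <= 23)%N ->
     exists (p m : nat) (l : 'I_6 -> R),
       [/\ (d, p, m) \in triples,
           convex_weights l,
           orbit_rule 11 (representatives R d p m) l &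
           positive_cubature 11 (rule_nodes (representatives R d p m) l)
             (rule_weight (representatives R d p m) l)])
  /\
  (forall d p m : nat, (d, p, m) \in triples -> odd d ->
     [/\ d = (2 * p - 1)%N, apar R d p = 4 &
         exists l : 'I_6 -> rat,
           convex_weights (fun i => ratr (l i) : R) /\
           orbit_rule 11 (representatives R d p m) (fun i => ratr (l i) : R)])
  /\
  (let l : 'I_6 -> R := fun i =>
     [:: 2 / 15; 1 / 15; 1 / 8; 0; 0; 27 / 40]`_i in
   convex_weights l /\ orbit_rule 11 (representatives R 3 2 4) l)
  /\
  (let l : 'I_6 -> R := fun i =>
     [:: 32 / 315; 1 / 105; 2 / 45; 0; 2 / 15; 32 / 45]`_i in
   convex_weights l /\ orbit_rule 11 (representatives R 7 4 4) l)
  /\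
  (let l : 'I_6 -> R := fun i =>
     [:: 0; 1 / 4095; 0; 0; 506 / 12285; 11776 / 12285]`_i in
   convex_weights l /\ orbit_rule 11 (representatives R 23 12 4) l).
Proof.
split; [|split; [|split; [|split; [|split]]]].
- move=> d p m /(triples_rule R)[_ w r].
  by exists (real_weights R (triple_weights (d, p, m))).
- move=> d d3.
  have /hasP[[[d' p] m] T /= /eqP dE] : has (fun t => t.1.1 == d) triples.
    (* The list [iota 3 21] runs from 3 to 23. *)
    have /allP/(_ d) : all (fun d => has (fun t => t.1.1 == d) triples) (iota 3 21).
      by vm_compute.
    by apply; rewrite mem_iota.
  rewrite {}dE in T; have [Y1 w r] := triples_rule R T.
  exists p, m, (real_weights R (triple_weights (d, p, m))).
  by split => //; exact: orbit_rule_positive_cubature.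
- move=> d p m T d_odd.
  have [dE p2] : d = (2 * p - 1)%N /\ (1 < p)%N.
    have : all (fun t => odd t.1.1 ==> (t.1.1 == 2 * t.1.2 - 1) && (1 < t.1.2))%N triples.
      by vm_compute.
    by move=> /allP/(_ _ T)/implyP/(_ d_odd)/andP[/eqP].
  split=> //.
    (* Hence the quotient defining a is 10 / 2 = 5, and a = 4; p > 1 keeps the denominator
       nonzero. *)
    have dR : d%:R - 1 = 2 * (p%:R - 1) :> R.
      by rewrite dE natrB ?natrM ?muln_gt0 ?(ltnW p2)// mulrBr mulr1 -addrA -opprD.
    have p1 : (p%:R - 1 : R) != 0 by rewrite subr_eq0 pnatr_eq1 gtn_eqF.
    by rewrite /apar dR; field.
  (* The table is rational, so it is read in [rat] and then embedded in the reals. *)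
  exists (real_weights rat (triple_weights (d, p, m))).
  have [_ w r] := triples_rule R T.
  suff -> : (fun i => ratr (real_weights rat (triple_weights (d, p, m)) i)) =
     real_weights R (triple_weights (d, p, m)) by [].
  by apply/funext => i; exact: ratr_of_Q.
- have [_ w r] := @triples_rule R 3 2 4 isT; move=> l.
  suff -> : l = real_weights R (triple_weights (3, 2, 4)%N) by [].
  apply/funext => -[[|[|[|[|[|[|//]]]]]] i6]; rewrite /l /real_weights /=.
  + by apply/esym/(@of_Q_fracE R 2 15); vm_compute.
  + by apply/esym/(@of_Q_fracE R 1 15); vm_compute.
  + by apply/esym/(@of_Q_fracE R 1 8); vm_compute.
  + by rewrite -(of_Q0 R); apply: eq_of_Q; vm_compute.
  + by rewrite -(of_Q0 R); apply: eq_of_Q; vm_compute.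
  + by apply/esym/(@of_Q_fracE R 27 40); vm_compute.
- have [_ w r] := @triples_rule R 7 4 4 isT; move=> l.
  suff -> : l = real_weights R (triple_weights (7, 4, 4)%N) by [].
  apply/funext => -[[|[|[|[|[|[|//]]]]]] i6]; rewrite /l /real_weights /=.
  + by apply/esym/(@of_Q_fracE R 32 315); vm_compute.
  + by apply/esym/(@of_Q_fracE R 1 105); vm_compute.
  + by apply/esym/(@of_Q_fracE R 2 45); vm_compute.
  + by rewrite -(of_Q0 R); apply: eq_of_Q; vm_compute.
  + by apply/esym/(@of_Q_fracE R 2 15); vm_compute.
  + by apply/esym/(@of_Q_fracE R 32 45); vm_compute.
- have [_ w r] := @triples_rule R 23 12 4 isT; move=> l.
  suff -> : l = real_weights R (triple_weights (23, 12, 4)%N) by [].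
  apply/funext => -[[|[|[|[|[|[|//]]]]]] i6]; rewrite /l /real_weights /=.
  + by rewrite -(of_Q0 R); apply: eq_of_Q; vm_compute.
  + by apply/esym/(@of_Q_fracE R 1 4095); vm_compute.
  + by rewrite -(of_Q0 R); apply: eq_of_Q; vm_compute.
  + by rewrite -(of_Q0 R); apply: eq_of_Q; vm_compute.
  + by apply/esym/(@of_Q_fracE R 506 12285); vm_compute.
  + by apply/esym/(@of_Q_fracE R 11776 12285); vm_compute.
Qed.
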